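(* Let $X_1,\dots,X_n$ be reflexive Banach spaces and $Y_1,\dots,Y_n$ Banach spaces. For each $i\in\{1,\dots,n\}$ let $T_i:X_i\to Y_i$ be a compact linear operator, let $K_i\subset X_i$ be a nonempty, bounded, closed and convex set, and let $A_i:Y_1\times\cdots\times Y_n\to\mathbb{R}$ be a continuous function, locally Lipschitz in the $i$th variable, which is differentiable in the $i$th variable and whose partial derivative $A_i':Y_1\times\cdots\times Y_n\times Y_i\to\mathbb{R}$ in the $i$th variable is continuous. Let $J:Y_1\times\cdots\times Y_n\to\mathbb{R}$ be a regular locally Lipschitz function. Then there exists $u^0=(u_1^0,\dots,u_n^0)\in K_1\times\cdots\times K_n$ such that for every $u=(u_1,\dots,u_n)\in K_1\times\cdots\times K_n$ and every $i\in\{1,\dots,n\}$, $$A_i'(Tu^0;T_iu_i-T_iu_i^0)+J_i^{\circ}(Tu^0;T_iu_i-T_iu_i^0)\ge 0 .$$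
   Context: All Banach spaces are real. For $u=(u_1,\dots,u_n)$, write $Tu=(T_1u_1,\dots,T_nu_n)$. $A_i'(y_1,\dots,y_n;h_i)$ denotes the derivative of $A_i$ with respect to the $i$th variable at $(y_1,\dots,y_n)$ applied to the direction $h_i\in Y_i$. $J_i^{\circ}$ denotes the partial Clarke derivative of $J$ in the $i$th variable: $$J_i^{\circ}(y_1,\dots,y_n;h_i)=\limsup_{w\to y_i,\ \tau\searrow 0}\frac{J(y_1,\dots,w+\tau h_i,\dots,y_n)-J(y_1,\dots,w,\dots,y_n)}{\tau},\qquad h_i\in Y_i,$$ where $w\in Y_i$ and $w+\tau h_i$ stand in the $i$th place. A locally Lipschitz function $j:Z\to\mathbb{R}$ on a Banach space $Z$ has Clarke directional derivative $j^{\circ}(u;v)=\limsup_{w\to u,\ \tau\searrow0}\frac{j(w+\tau v)-j(w)}{\tau}$. It is called regular if for all $u,v\in Z$ the one-sided directional derivative $j'(u;v)=\lim_{\tau\searrow 0}\frac{j(u+\tau v)-j(u)}{\tau}$ exists and equals $j^{\circ}(u;v)$. *)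

(* Defs.v *)
From HB Require Import structures.
From mathcomp Require Import all_boot all_order all_algebra.
From mathcomp Require Import all_classical all_reals all_analysis.

Set Implicit Arguments.
Unset Strict Implicit.
Unset Printing Implicit Defensive.

Import Order.TTheory GRing.Theory Num.Theory.
Import numFieldNormedType.Exports.

Local Open Scope classical_set_scope.
Local Open Scope ring_scope.

(* The library's [prod_topology] carries no vector space structure, hence this
   separate copy of the dependent product, a Banach space for the max norm
   (which induces the product topology, as I is finite). *)
Definition banach_prod (R : realType) (I : finType)
  (Y : I -> completeNormedModType R) : Type := forall i, Y i.

Section banach_prod_structure.
Context (R : realType) (I : finType) (Y : I -> completeNormedModType R).
Local Notation Z := (banach_prod Y).
Implicit Types x y z : Z.

HB.instance Definition _ := gen_eqMixin Z.
HB.instance Definition _ := gen_choiceMixin Z.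

Let add x y : Z := fun i => x i + y i.
Let opp x : Z := fun i => - x i.
Let scale (a : R) x : Z := fun i => a *: x i.

Let addA : associative add.
Proof. by move=> x y z; apply: functional_extensionality_dep => i; exact: addrA. Qed.
Let addC : commutative add.
Proof. by move=> x y; apply: functional_extensionality_dep => i; exact: addrC. Qed.
Let add0 : left_id ((fun i => 0) : Z) add.
Proof. by move=> x; apply: functional_extensionality_dep => i; exact: add0r. Qed.
Let addN : left_inverse ((fun i => 0) : Z) opp add.
Proof. by move=> x; apply: functional_extensionality_dep => i; exact: addNr. Qed.

HB.instance Definition _ := GRing.isZmodule.Build Z addA addC add0 addN.

Let scaleA a b x : scale a (scale b x) = scale (a * b) x.
Proof. by apply: functional_extensionality_dep => i; exact: scalerA. Qed.
Let scale1 : left_id 1 scale.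
Proof. by move=> x; apply: functional_extensionality_dep => i; exact: scale1r. Qed.
Let scaleDr : right_distributive scale +%R.
Proof. by move=> a x y; apply: functional_extensionality_dep => i; exact: scalerDr. Qed.
Let scaleDl x : {morph scale^~ x : a b / a + b}.
Proof. by move=> a b; apply: functional_extensionality_dep => i; exact: scalerDl. Qed.

HB.instance Definition _ :=
  GRing.Zmodule_isLmodule.Build R Z scaleA scale1 scaleDr scaleDl.

Let norm x : R := \big[Num.max/0]_(i : I) `|x i|.

Let norm_ge x i : `|x i| <= norm x.
Proof. exact: le_bigmax. Qed.

Let norm_le x (M : R) : 0 <= M -> (forall i, `|x i| <= M) -> norm x <= M.
Proof. by move=> M0 xM; apply: bigmax_le. Qed.

Let norm_ge0 x : 0 <= norm x.
Proof. exact: bigmax_ge_id. Qed.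

Let normD x y : norm (x + y) <= norm x + norm y.
Proof.
apply: norm_le => [|i]; first by rewrite addr_ge0 ?norm_ge0.
exact: le_trans (ler_normD _ _) (lerD (norm_ge x i) (norm_ge y i)).
Qed.

Let normZ_le a x : norm (a *: x) <= `|a| * norm x.
Proof.
apply: norm_le => [|i]; first by rewrite mulr_ge0 ?norm_ge0.
by rewrite [leLHS]normrZ ler_wpM2l ?norm_ge.
Qed.

Let normZ a x : norm (a *: x) = `|a| * norm x.
Proof.
apply/eqP; rewrite eq_le normZ_le /=.
have [->|a0] := eqVneq a 0; first by rewrite normr0 mul0r norm_ge0.
rewrite -ler_pdivlMl ?normr_gt0// -normfV.
by rewrite -{1}[x]scale1r -(mulVf a0) -scalerA normZ_le.
Qed.

Let norm0_eq0 x : norm x = 0 -> x = 0.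
Proof.
move=> x0; apply: functional_extensionality_dep => i; apply/eqP.
by rewrite -normr_le0 -x0 norm_ge.
Qed.

HB.instance Definition _ := Lmodule_isNormed.Build R Z normD normZ norm0_eq0.

Lemma banach_prod_norm_le x (M : R) :
  0 <= M -> (`|x| <= M <-> forall i, `|x i| <= M).
Proof.
move=> M0; split=> [xM i|]; first exact: le_trans (norm_ge x i) xM.
exact: norm_le.
Qed.

Let complete (F : set_system Z) : ProperFilter F -> cauchy F -> cvg F.
Proof.
move=> FF /cauchyP Fc.
have cv i : cvg ((fun y : Z => y i) @ F).
  apply: cauchy_cvg; apply/cauchyP => e e0.
  have [z Fz] := Fc _ e0; exists (z i).
  apply: (@filterS _ F _ (ball z e)) => // y.
  rewrite -!ball_normE /=; apply: le_lt_trans; move: i.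
  exact: (banach_prod_norm_le (z - y) (normr_ge0 _)).1.
pose l : Z := fun i => lim ((fun y : Z => y i) @ F).
apply/cvg_ex; exists l; apply/cvgrPdist_le => e e0.
have : \forall y \near F, forall i, `|l i - y i| <= e.
  by apply: filter_forall => i; by move/cvgrPdist_le: (cv i); exact.
by apply: filterS => y ly; apply/banach_prod_norm_le => //; exact: ltW.
Qed.

HB.instance Definition _ := Uniform_isComplete.Build Z complete.

End banach_prod_structure.

Section clarke.
Context (R : realType) (Z : normedModType R).
Implicit Types (j : Z -> R) (u v : Z).

Definition locally_lipschitz j :=
  forall u, exists2 U, nbhs u U & [lipschitz j w | w in U].

(* Extended-real valued; finite when j is locally Lipschitz. *)
Definition clarke j u v : \bar R :=
  limf_esup (fun p : Z * R => ((j (p.1 + p.2 *: v) - j p.1) / p.2)%:E)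
    (filter_prod (nbhs u) (0^'+)).

Definition regular j := forall u v,
  ((j (u + t *: v) - j u) / t)%:E @[t --> 0^'+] --> clarke j u v.

End clarke.

Section partial.
Context (R : realType) (I : finType) (Y : I -> completeNormedModType R).
Implicit Types (f : banach_prod Y -> R) (y : banach_prod Y).

Definition slice f y i : Y i -> R := fun w => f (dfwith y i w).
Arguments slice : clear implicits.

Definition partial_diff f i y (h : Y i) : R := 'd (slice f y i) (y i) h.

Definition partial_clarke f i y (h : Y i) : \bar R :=
  clarke (slice f y i) (y i) h.

End partial.
Arguments slice {R I Y} f y i.
Arguments partial_diff {R I Y} f i y h.
Arguments partial_clarke {R I Y} f i y h.

Section operators.
Context (R : realType).

Definition compact_operator (X Y : normedModType R) (T : X -> Y) :=
  forall B, bounded_set B -> precompact (T @` B).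

Definition dual (X : normedModType R) : set (X -> R^o) :=
  [set f | linear f /\ continuous f].

Definition dual_norm (X : normedModType R) (f : X -> R^o) : R :=
  sup [set `|f x| | x in [set x : X | `|x| <= 1]].

(* Only the values on [dual X] matter. *)
Definition bidual (X : normedModType R) : set ((X -> R^o) -> R) :=
  [set Phi |
    (forall a f g, dual f -> dual g -> Phi (a *: f + g) = a * Phi f + Phi g) /\
    (exists C, forall f, dual f -> `|Phi f| <= C * dual_norm f)].

(* The canonical embedding into the bidual is onto. *)
Definition reflexive_space (X : normedModType R) :=
  forall Phi, @bidual X Phi -> exists x, forall f, dual f -> Phi f = f x.

End operators.

(* Main.v *)
From HB Require Import structures.
Require Import Defs.
From mathcomp Require Import all_boot all_order all_algebra.
From mathcomp Require Import all_classical all_reals all_analysis.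
From mathcomp Require Import finmap zify ring lra.

(** The unknown enters the inequality only through [y = Tu], which ranges over
the product [C] of the sets [T i @` K i].  Reflexivity turns a bounded closed
convex [K i] into a weakly compact set, and a compact operator maps it onto a
norm compact set ([compact_operator_image]); so [C] is compact and convex.

Call [v] a descent point for [y] when
[\sum_i A_i'(y; v i - y i) + J°(y; v - y) < 0].  Upper semicontinuity of [J°]
makes the set of all [y] with a given descent point [v] open ([open_descent]).  If every
point of [C] had a descent point in [C], these open sets would cover [C], and
[open_cover_supported] would give a convex combination [p] of points [v j] all
of which, as far as their weights are positive, are descent points for [p].
The left-hand side above is sublinear in [v - y], so averaging over the [v j]
yields [J°(p; 0) < 0], which is absurd.  Hence some [y] in [C] has no descent
point in [C] ([no_descent]).  Testing this with a [v] that differs from [y] in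
the [i]th coordinate only leaves [A_i'(y; h) + J°(y; (0, .., h, .., 0)) >= 0].
By regularity [J°] is here a one-sided derivative along the [i]th axis, and such
a derivative is at most the partial Clarke derivative [J_i°(y; h)].

[open_cover_supported] is where a fixed point theorem is needed: it is as strong
as Brouwer's theorem.  It rests on a lemma of Scarf ([scarf]), a parity argument
in the manner of Sperner's lemma in which the cells are the subsets of a finite
set that are dominant for a family of linear orders.  Applied to the points of a
fine grid in the standard simplex, ordered by each barycentric coordinate, this
avoids any triangulation ([grid_supported_colours]).

Compactness of [T i @` K i] needs separation of a point from a closed convex
set, hence a Hahn-Banach theorem ([mazur_orlicz]). *)

Set Implicit Arguments.
Unset Strict Implicit.
Unset Printing Implicit Defensive.

Import Order.TTheory GRing.Theory Num.Theory.
Import numFieldNormedType.Exports.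

(** * Parity of colourful cells *)

Section double_point.
Variables (W I : finType) (f : W -> I).
Implicit Types S : {set W}.

(** A map that loses exactly one value in cardinality identifies exactly one pair,
and the members of that pair are the points that can be dropped without changing
the image.  Both parity counts below reduce to this. *)
Lemma card_double S : #|f @: S|.+1 = #|S| ->
  #|[set x in S | f @: (S :\ x) == f @: S]| = 2.
Proof.
move=> fS.
have [x0 x0S fx0] : exists2 x, x \in S & f @: (S :\ x) == f @: S.
  apply/exists_inP; apply: contraT => /exists_inPn /= nx.
  suff /card_in_imset : {in S &, injective f} by move=> E; move: fS; rewrite E; lia.
  move=> x y xS yS fxy; apply/eqP; apply: contraT => xy.
  move: (nx x xS); rewrite finset.eqEsubset imsetS ?subD1set//=.
  case/negP; apply/fintype.subsetP => _ /imsetP[z zS ->].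
  have [->|zx] := eqVneq z x; last by rewrite imset_f// !inE zx.
  by rewrite fxy imset_f// !inE eq_sym xy.
have injf : {in S :\ x0 &, injective f}.
  apply/imset_injP; rewrite (eqP fx0).
  by have := cardsD1 x0 S; rewrite x0S -fS add1n => -[->].
have [x1 x1S fx1] : exists2 x, x \in S :\ x0 & f x0 = f x.
  by apply/imsetP; rewrite (eqP fx0) imset_f.
have x10 : x0 != x1 by move: x1S; rewrite !inE eq_sym => /andP[].
suff -> : [set x in S | f @: (S :\ x) == f @: S] = [set x0; x1].
  by rewrite cards2 x10.
apply/finset.setP => x; rewrite !inE; apply/andP/idP; last first.
  case/orP=> /eqP->; first by rewrite x0S fx0.
  move: (x1S); rewrite !inE => /andP[_ x1S']; split=> //.
  rewrite finset.eqEsubset imsetS ?subD1set//=.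
  apply/fintype.subsetP => _ /imsetP[z zS ->].
  have [->|zx] := eqVneq z x1; last by rewrite imset_f// !inE zx.
  by rewrite -fx1 imset_f// !inE x10.
case=> xS /eqP fx; apply: contraT; rewrite negb_or => /andP[xx0 xx1].
have /imsetP[z] : f x \in f @: (S :\ x) by rewrite fx imset_f.
rewrite !inE => /andP[zx zS] fxz.
have [zx0|zx0] := eqVneq z x0.
  have xS0 : x \in S :\ x0 by rewrite !inE xx0.
  have E : x = x1 by apply: injf; rewrite // fxz zx0.
  by rewrite E eqxx in xx1.
have := injf x z; rewrite !inE xx0 xS zx0 zS fxz => /(_ isT isT erefl) E.
by rewrite E eqxx in zx.
Qed.

End double_point.

Section sperner.
Variables (W I : finType) (c : W -> I).
Implicit Types (S D : {set W}) (rooms : {set {set W}}).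

(** A colourful cell has a single facet that misses just the colour [i0]; in any
other cell such facets come in pairs, by [card_double]. *)
Lemma facet_parity (i0 : I) S : #|S| = #|I| ->
  odd #|[set x in S | c @: (S :\ x) == [set~ i0]]| = (c @: S == [set: I]).
Proof.
move=> Sn; have [cS|cS] := eqVneq (c @: S) [set: I].
  have injc : {in S &, injective c}.
    by apply/imset_injP; rewrite cS cardsT Sn.
  have /imsetP[x0 x0S cx0] : i0 \in c @: S by rewrite cS inE.
  suff -> : [set x in S | c @: (S :\ x) == [set~ i0]] = [set x0] by rewrite cards1.
  apply/finset.setP => x; rewrite !inE; apply/andP/eqP => [[xS /eqP cx]|->].
    apply/eqP; apply: contraT; rewrite eq_sym => xx0.
    have : c x0 \in c @: (S :\ x) by rewrite imset_f// !inE xx0.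
    by rewrite cx !inE cx0 eqxx.
  split=> //; apply/eqP/finset.setP => j; rewrite !inE.
  apply/imsetP/idP => [[z]|ji].
    rewrite !inE => /andP[zx0 zS] ->; rewrite cx0.
    by apply: contra zx0 => /eqP /injc -> //.
  have /imsetP[z zS jz] : j \in c @: S by rewrite cS inE.
  exists z => //; rewrite !inE zS andbT.
  by apply: contra ji => /eqP zx0; rewrite jz zx0 cx0.
have [->|[x0]] := finset.set_0Vmem [set x in S | c @: (S :\ x) == [set~ i0]].
  by rewrite cards0.
rewrite inE => /andP[x0S /eqP cx0].
have cSE : c @: S = [set~ i0].
  have : c @: S = c x0 |: [set~ i0] by rewrite -cx0 -imsetU1 finset.setD1K.
  have [->|ci0] := eqVneq (c x0) i0; first by rewrite finset.setUCr => E; rewrite E eqxx in cS.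
  move=> ->; apply/finset.setUidPr; apply/fintype.subsetP => z.
  by rewrite !inE => /eqP ->.
rewrite -cSE card_double//= cSE Sn.
by rewrite -(cardsC [set i0]) cards1.
Qed.

Lemma odd_sum (T : finType) (P : pred T) (F : T -> nat) :
  odd (\sum_(x | P x) F x) = odd #|[set x | P x & odd (F x)]|.
Proof.
rewrite -sum1_card (big_morph odd oddD (erefl _)) (big_morph odd oddD (erefl _)).
rewrite big_mkcond [RHS]big_mkcond/=; apply: eq_bigr => x _; rewrite inE.
by case: (P x) => //=; case: odd.
Qed.

(** Sperner's double counting of the pairs of a cell and a facet coloured by all
colours but [i0]: each facet lies in an even number of cells, so the number of
pairs is even, and by [facet_parity] it has the parity of the number of
colourful cells. *)
Lemma even_colourful (i0 : I) rooms :
  (forall S, S \in rooms -> #|S| = #|I|) ->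
  (forall D, #|D|.+1 = #|I| -> ~~ odd #|[set x | x \notin D & x |: D \in rooms]|) ->
  ~~ odd #|[set S in rooms | c @: S == [set: I]]|.
Proof.
move=> rooms_card evenD.
have -> : [set S in rooms | c @: S == [set: I]] =
  [set S | S \in rooms & odd #|[set x in S | c @: (S :\ x) == [set~ i0]]|].
  apply/finset.setP => S; rewrite !inE.
  by have [SR|//] := boolP (S \in rooms); rewrite facet_parity// rooms_card.
rewrite -odd_sum.
pose Dr := [set D : {set W} | c @: D == [set~ i0] & #|D|.+1 == #|I|].
suff -> : \sum_(S in rooms) #|[set x in S | c @: (S :\ x) == [set~ i0]]| =
    \sum_(D in Dr) #|[set x | x \notin D & x |: D \in rooms]|.
  rewrite odd_sum; rewrite (_ : [set _ | _ & _] = finset.set0) ?cards0//.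
  apply/finset.setP => D; rewrite !inE; apply/negbTE; rewrite negb_and.
  by have [/eqP/evenD ->|] := boolP (#|D|.+1 == #|I|); rewrite ?orbT// andbF.
transitivity (\sum_(S in rooms) \sum_(x in S | c @: (S :\ x) == [set~ i0]) 1).
  by apply: eq_bigr => S _; rewrite sum1_card; apply: eq_card => x; rewrite !inE.
transitivity (\sum_(D in Dr) \sum_(x | (x \notin D) && (x |: D \in rooms)) 1); last first.
  by apply: eq_bigr => S _; rewrite sum1_card; apply: eq_card => x; rewrite !inE.
rewrite !pair_big_dep/=.
rewrite (reindex_onto (fun p : {set W} * W => (p.2 |: p.1, p.2))
   (fun p => (p.1 :\ p.2, p.2)))/=; last first.
  by move=> [S x] /= /and3P[_ xS _]; rewrite finset.setD1K.
apply: eq_bigl => -[D x] /=.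
rewrite !inE eqxx/=.
have [xD|xD] := boolP (x \in D) => /=.
  rewrite !andbF; apply/negbTE; rewrite negb_and; apply/orP; right.
  by apply/eqP => -[E]; move: xD; rewrite -E !inE eqxx.
rewrite finset.setU1K// eqxx !andbT.
have [xDR|] := boolP (_ \in rooms) => /=; last by rewrite andbF.
by have := rooms_card _ xDR; rewrite cardsU1 xD add1n => ->; rewrite eqxx !andbT.
Qed.

End sperner.
(** * Scarf's lemma *)

(** Each [r i] ranks the points of [W] by a linear order.  The points [b i] are
ideal boundary points that close up the cell complex: [b i] is the least
element of the order [i], and in any other order it lies above all points that
are not of the form [b k]. *)
Section scarf.
Variables (W I : finType) (r : I -> W -> nat) (b : I -> W).
Hypothesis r_inj : forall i, injective (r i).
Hypothesis b_inj : injective b.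
Hypothesis b_low : forall i x, r i (b i) <= r i x.
Hypothesis b_high : forall i j x, i != j -> x \notin codom b -> r i x < r i (b j).
Implicit Types (S D : {set W}).

(** In the simplex, with the order [i] given by the [i]th coordinate, this says
that the simplex cut out by the lower bounds of [S] has no point inside; such an
[S] is small, which is what replaces the cells of a triangulation. *)
Definition dominant S := [forall y, exists i, [forall x in S, r i y <= r i x]].

Lemma dominantP S :
  reflect (forall y, exists i, {in S, forall x, r i y <= r i x}) (dominant S).
Proof.
apply: (iffP forallP) => H y.
  by have /existsP[i /forall_inP Hi] := H y; exists i.
by have [i Hi] := H y; apply/existsP; exists i; apply/forall_inP.
Qed.

Lemma min_rankP i D x0 : x0 \in D ->
  {x | x \in D & {in D, forall z, r i x <= r i z}}.
Proof. by move=> x0D; case: (arg_minnP (r i) x0D) => x xD xmin; exists x. Qed.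

(** The minima [m i] of the orders [i] on [D] exhaust [D], which has one element
less than there are orders; hence exactly two orders share their minimum with
another one.  A cell containing the facet [D] arises by adding a point [x] that
takes over the role of minimum in one of these two orders, and [x] must then be
the largest point, in that order, among those that leave the other minima in
place. *)
Lemma interior_facet D v : v \in D -> v \notin codom b -> #|D|.+1 = #|I| ->
  dominant D -> #|[set x | x \notin D & dominant (x |: D)]| = 2.
Proof.
move=> vD vb cD /dominantP domD.
pose m i := s2val (min_rankP i vD).
have mD i : m i \in D := s2valP (min_rankP i vD).
have m_min i z : z \in D -> r i (m i) <= r i z.
  exact: (s2valP' (min_rankP i vD) z).
have m_uniq i z : z \in D -> {in D, forall x, r i z <= r i x} -> z = m i.
  by move=> zD zmin; apply: (@r_inj i); apply/anti_leq; rewrite zmin//= m_min.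
have mI : m @: [set: I] = D.
  apply/finset.setP => z; apply/imsetP/idP => [[i _ ->]//|zD].
  by have [i Hi] := domD z; exists i => [|]; [by rewrite inE|exact: m_uniq].
(* The orders whose minimum is also the minimum of another order. *)
pose Dbl := [set i | m @: [set~ i] == D].
have cDbl : #|Dbl| = 2.
  have := @card_double _ _ m [set: I]; rewrite mI cD cardsT => /(_ erefl) <-.
  by apply: eq_card => i; rewrite !inE finset.setTD.
(* The points that can be added without changing the minima of orders other
   than i. *)
pose T i := [pred y | [forall k, (k != i) ==> (r k (m k) < r k y)]].
have TP i y : reflect (forall k, k != i -> r k (m k) < r k y) (T i y).
  by apply: (iffP forall_inP).
have bT i : T i (b i).
  apply/TP => k ki; apply: leq_ltn_trans (m_min _ _ vD) _.
  exact: b_high.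
pose g i := [arg max_(y > b i | T i y) r i y].
have gT i : T i (g i) by rewrite /g; case: arg_maxnP.
have gmax i y : T i y -> r i y <= r i (g i).
  by rewrite /g; case: arg_maxnP => // x _; apply.
have Dm i z : i \in Dbl -> z \in D -> exists2 k, k != i & z = m k.
  rewrite inE => /eqP <- /imsetP[k]; rewrite !inE => ki ->; by exists k.
have gD i : i \in Dbl -> g i \notin D.
  move=> iDbl; apply/negP => /(Dm _ _ iDbl)[k ki gk].
  by have /TP/(_ _ ki) := gT i; rewrite gk ltnn.
have gle i z : i \in Dbl -> z \in D -> r i (g i) <= r i z.
  have [k Hk] := domD (g i); have [E|ki] := eqVneq k i; first by subst k => _; exact: Hk.
  by have /TP/(_ _ ki) := gT i; rewrite ltnNge Hk.
suff -> : [set x | x \notin D & dominant (x |: D)] = g @: Dbl.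
  rewrite card_in_imset// => i k iDbl kDbl gik; apply/eqP; apply: contraT => ik.
  have /TP/(_ k) := gT i; rewrite eq_sym => /(_ ik).
  by rewrite gik ltnNge gle.
apply/finset.setP => x; rewrite inE; apply/andP/imsetP => [[xD /dominantP domx]|].
  have [i xi] := domx x; have xi' z : z \in D -> r i x < r i z.
    move=> zD; rewrite ltn_neqAle xi ?inE ?zD ?orbT// andbT.
    by apply: contra xD => /eqP/r_inj ->.
  have below k z : z \in D -> {in x |: D, forall y, r k z <= r k y} ->
      k != i /\ z = m k.
    move=> zD zk; split.
      apply/eqP => ki; subst k.
      by have := zk x; rewrite !inE eqxx leqNgt xi'// => /(_ isT).
    by apply: m_uniq => // y yD; apply: zk; rewrite inE yD orbT.
  have iDbl : i \in Dbl.
    rewrite inE finset.eqEsubset -{1}mI imsetS ?finset.subsetT//=.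
    apply/fintype.subsetP => z zD; have [k zk] := domx z.
    by have [ki ->] := below k z zD zk; rewrite imset_f// !inE.
  exists i => //.
  have xT : T i x.
    apply/TP => k ki; rewrite ltnNge; apply/negP => xk.
    suff : D \subset m @: ([set~ i] :\ k).
      move=> /subset_leq_card; rewrite leqNgt => /negP; apply.
      apply: leq_ltn_trans (leq_imset_card _ _) _.
      have := cardsC [set i]; have := cardsD1 k [set~ i].
      by rewrite cards1 !inE ki; lia.
    apply/fintype.subsetP => z zD; have [l zl] := domx z.
    have [li zml] := below l z zD zl.
    rewrite zml imset_f// !inE li andbT; apply/eqP => lk.
    have := zl x; rewrite !inE eqxx => /(_ isT); rewrite zml lk => mx.
    have : x = m k by apply: (@r_inj k); apply/anti_leq; rewrite mx xk.
    by move=> E; move: xD; rewrite E mD.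
  apply: (@r_inj i); apply/anti_leq; rewrite gmax//=.
  have [k Hk] := domx (g i).
  have [E|ki] := eqVneq k i; first by subst k; apply: Hk; rewrite !inE eqxx.
  have /TP/(_ _ ki) := gT i.
  by rewrite ltnNge Hk// !inE mD orbT.
move=> [i iDbl ->]; split; first exact: gD.
apply/dominantP => y; have [yT|/TP yT] := boolP (T i y).
  exists i => z; rewrite !inE => /orP[/eqP ->|zD]; first exact: gmax.
  exact: leq_trans (gmax _ _ yT) (gle _ _ iDbl zD).
have [k [ki yk]] : exists k, k != i /\ r k y <= r k (m k).
  apply: contra_notP yT => /forallNP nk k ki; rewrite ltnNge.
  by apply/negP => yk; apply: (nk k).
exists k => z; rewrite !inE => /orP[/eqP ->|zD].
  by apply: ltnW; apply: leq_ltn_trans yk _; have /TP := gT i; exact.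
exact: leq_trans yk (m_min _ _ zD).
Qed.

(** The facet [b @: [set~ i0]] lies in only one dominant cell, obtained by adding
the largest interior point of the order [i0].  Declaring [b @: [set: I]] to be a
cell provides the second one. *)
Lemma boundary_facet i0 v : v \notin codom b ->
  let D := b @: [set~ i0] in
  #|[set x | x \notin D & dominant (x |: D) || (x |: D == b @: [set: I])]| = 2.
Proof.
move=> vb D.
have ltb i j : j != i -> r i (b i) < r i (b j).
  move=> ji; rewrite ltn_neqAle b_low andbT.
  by apply: contra ji => /eqP /r_inj /b_inj ->.
have low x i : x \notin codom b -> r i (b i) < r i x.
  move=> xb; rewrite ltn_neqAle b_low andbT.
  by apply: contra xb => /eqP /r_inj <-; exact: codom_f.
have inD i : b i \in D = (i != i0) by rewrite mem_imset// !inE.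
case: (@arg_maxnP _ v [pred x | x \notin codom b] (r i0) vb) => x' /= x'b x'max.
suff -> : [set x | x \notin D & dominant (x |: D) || (x |: D == b @: [set: I])] =
    [set b i0; x'].
  rewrite cards2; case: eqP => // E.
  by move: x'b; rewrite -E /= codom_f.
have nbD x : x \notin codom b -> x \notin D.
  by apply: contra => /imsetP[k _ ->]; exact: codom_f.
have bI : b i0 |: D = b @: [set: I].
  by rewrite /D -imsetU1 finset.setUCr.
apply/finset.setP => x; rewrite !inE; apply/andP/idP; last first.
  case/orP => /eqP ->; first by rewrite inD eqxx bI eqxx orbT.
  split; first exact: nbD.
  apply/orP; left; apply/dominantP => y.
  have [/codomP[j ->]|yb] := boolP (y \in codom b).
    by exists j => x1 _; exact: b_low.
  exists i0 => z; rewrite !inE => /orP[/eqP ->|]; first exact: x'max.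
  by case/imsetP => j; rewrite !inE => ji ->; apply: ltnW; apply: b_high; rewrite // eq_sym.
have [/codomP[j ->]|xb] := boolP (x \in codom b).
  by rewrite inD negbK => -[/eqP ->]; rewrite eqxx.
move=> [xD /orP[/dominantP/(_ x')[k Hk]|/eqP E]]; last first.
  have : x \in b @: [set: I] by rewrite -E !inE eqxx.
  by case/imsetP => j _ xj; rewrite xj codom_f in xb.
apply/orP; right; apply/eqP.
have [ki0|ki0] := eqVneq k i0.
  apply: (@r_inj i0); apply/anti_leq; rewrite x'max//=.
  by rewrite -ki0; apply: Hk; rewrite !inE eqxx.
have := Hk (b k); rewrite !inE inD ki0 orbT => /(_ isT).
by rewrite leqNgt low.
Qed.

Lemma dominantS S D : D \subset S -> dominant S -> dominant D.
Proof.
move=> /fintype.subsetP DS /dominantP domS; apply/dominantP => y.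
by have [i Hi] := domS y; exists i => x /DS; exact: Hi.
Qed.

(** With the artificial cell [b @: [set: I]] every facet lies in an even number of
cells, so the number of colourful cells is even; the artificial cell is one of
them, and another one must exist. *)
Theorem scarf (c : W -> I) v : v \notin codom b -> (forall i, c (b i) = i) ->
  exists S, [/\ dominant S, c @: S = [set: I] &
    exists2 x, x \in S & x \notin codom b].
Proof.
move=> vb cb.
pose rooms := [set S : {set W} | #|S| == #|I| & dominant S || (S == b @: [set: I])].
have b_room : b @: [set: I] \in rooms.
  by rewrite inE card_imset// cardsT eqxx eqxx orbT.
have : ~~ odd #|[set S in rooms | c @: S == [set: I]]|.
  apply: (@even_colourful _ _ c (c v)) => [S|D cD]; first by rewrite inE => /andP[/eqP].
  have -> : [set x | x \notin D & x |: D \in rooms] =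
    [set x | x \notin D & dominant (x |: D) || (x |: D == b @: [set: I])].
    apply/finset.setP => x; rewrite !inE; have [//|xD/=] := boolP (x \in D).
    by rewrite cardsU1 xD add1n cD eqxx.
  have [Db|/fintype.subsetPn[w wD wb]] := boolP (D \subset codom b).
    have [i0 i0D] : exists i0, b i0 \notin D.
      apply/existsP; apply: contraT; rewrite negb_exists => /forallP bD.
      suff : #|codom b| <= #|D| by rewrite card_codom// -cD ltnn.
      apply: subset_leq_card; apply/fintype.subsetP => _ /codomP[i ->].
      by have := bD i; rewrite negbK.
    have -> : D = b @: [set~ i0].
      apply/eqP; rewrite eqEcard card_imset//.
      have := cardsC [set i0]; rewrite cards1 add1n -cD => -[->].
      rewrite leqnn andbT; apply/fintype.subsetP => z zD.
      have /codomP[j zj] := fintype.subsetP Db _ zD.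
      rewrite zj imset_f// !inE; apply: contra i0D => /eqP <-.
      by rewrite -zj.
    by rewrite (boundary_facet _ vb).
  have nb x : x |: D == b @: [set: I] = false.
    apply/negP => /eqP E; have : w \in b @: [set: I] by rewrite -E !inE wD orbT.
    by case/imsetP => j _ wj; rewrite wj codom_f in wb.
  under eq_finset => x do rewrite nb orbF.
  have [domD|ndomD] := boolP (dominant D); first by rewrite (interior_facet wD).
  rewrite (_ : [set _ | _ & _] = finset.set0) ?cards0//.
  apply/finset.setP => x; rewrite !inE; apply/negP => /andP[_ dx].
  by case/negP: ndomD; apply: dominantS dx; exact: finset.subsetUr.
have bC : b @: [set: I] \in [set S in rooms | c @: S == [set: I]].
  rewrite inE b_room/= -imset_comp; apply/eqP/finset.setP => i.
  by rewrite [RHS]inE -{1}[i]cb (imset_f (c \o b))// inE.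
rewrite (cardsD1 (b @: [set: I])) bC /= negbK.
have [->|[S]] := finset.set_0Vmem ([set S in rooms | c @: S == [set: I]] :\ b @: [set: I]).
  by rewrite cards0.
rewrite !inE => /andP[Sb /andP[/andP[/eqP Sn]]]; rewrite (negbTE Sb) orbF => domS /eqP cS _.
exists S; split=> //.
apply/exists_inP; apply: contraT => /exists_inPn nS; case/negP: Sb.
rewrite eqEcard card_imset// cardsT Sn leqnn andbT.
apply/fintype.subsetP => z /nS /=; rewrite negbK => /codomP[j ->].
by rewrite imset_f// inE.
Qed.

End scarf.

(** * Colourings of a grid in the simplex *)

(** Heights may have ties, so [scarf] is applied to the lexicographic order on the
height and on an enumeration of [V].  The set [C] collects the orders whose
boundary point is not in the cell. *)
Section heights.
Variables (V I : finType) (h : I -> V -> nat).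

Let M := #|V|.
Let N := \max_(p : I * V) h p.1 p.2.

Let rank (i : I) (w : V + I) : nat :=
  match w with
  | inl x => (h i x * M + enum_rank x).+1
  | inr j => if j == i then 0 else (N.+1 * M + enum_rank j).+1
  end.

Let ltM (x : V) : enum_rank x < M := ltn_ord _.

Let rank_lt i x : h i x * M + enum_rank x < N.+1 * M.
Proof.
have hN : h i x <= N := @leq_bigmax _ (fun p : I * V => h p.1 p.2) (i, x).
have hM : h i x * M <= N * M by rewrite leq_mul2r hN orbT.
have := ltM x; lia.
Qed.

Let rank_le i x y : rank i (inl x) <= rank i (inl y) -> h i x <= h i y.
Proof.
rewrite /rank ltnS => xy; rewrite leqNgt; apply/negP => yx.
have : (h i y).+1 * M <= h i x * M by rewrite leq_mul2r yx orbT.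
have := ltM y; rewrite mulSn; lia.
Qed.

Let rank_inj i : injective (rank i).
Proof.
move=> [x|j] [y|k]; rewrite /rank.
- case=> /(congr1 (modn^~ M)); rewrite !modnMDl !modn_small// => E.
  by congr inl; apply: enum_rank_inj; exact: val_inj.
- case: eqP => // _ [] E; have := rank_lt i x; by rewrite E ltnNge leq_addr.
- case: eqP => // _ [] E; have := rank_lt i y; by rewrite -E ltnNge leq_addr.
- case: eqP => [->|_]; case: eqP => [->|_] // [] /addnI E.
  by congr inr; apply: enum_rank_inj; exact: val_inj.
Qed.

Lemma scarf_heights (c : V -> I) (v0 : V) :
  exists (S : {set V}) (C : {set I}), [/\ exists x, x \in S,
    forall i, i \in C -> exists2 x, x \in S & c x = i &
    forall y, exists2 i, i \in C & forall x, x \in S -> h i y <= h i x].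
Proof.
pose cW (w : V + I) := match w with inl x => c x | inr i => i end.
have inlb (x : V) : (inl x : V + I) \notin codom inr.
  by apply/negP => /codomP[].
have [] := @scarf _ _ rank inr rank_inj (@inr_inj _ _) _ _ cW _ (inlb v0) (fun=> erefl).
- by move=> i x; rewrite /= eqxx.
- move=> i j [x|k] ij; last by rewrite codom_f.
  rewrite /= [j == i]eq_sym (negbTE ij) => _; rewrite ltnS.
  exact: leq_trans (rank_lt i x) (leq_addr _ _).
move=> S [/dominantP domS cS [[x0|k] x0S x0b]]; last by rewrite codom_f in x0b.
exists [set x | inl x \in S], [set i | inr i \notin S]; split.
- by exists x0; rewrite inE.
- move=> i; rewrite inE => iS.
  have /imsetP[[x|k] kS ik] : i \in cW @: S by rewrite cS inE.
    by exists x; rewrite ?inE.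
  by move: iS; rewrite ik /= kS.
- move=> y; have [i Hi] := domS (inl y); exists i => [|x].
    by rewrite inE; apply/negP => /Hi /=; rewrite eqxx.
  by rewrite inE => xS; exact: rank_le (Hi _ xS).
Qed.

End heights.

Lemma leq_sum_excess (I : finType) (m x : I -> nat) j :
  (forall i, m i <= x i) -> x j <= m j + (\sum_i x i - \sum_i m i).
Proof.
move=> mx; rewrite (bigD1 j)//= [X in _ - X](bigD1 j)//=.
have := mx j; have : \sum_(i | i != j) m i <= \sum_(i | i != j) x i.
  by apply: leq_sum => i _; exact: mx.
lia.
Qed.

(** The grid points are the vectors of naturals with sum [N].  The cell [S] given
by [scarf_heights] has lower bounds [m] on the coordinates in [C]; as no grid
point exceeds [m] on all of [C], the sum of [m] is within [#|I|] of [N], and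
every point of [S] is coordinatewise within [#|I|] of [m].  Raising one
coordinate of [m] turns it into a grid point [p] supported in [C], and every
element of [C] is the colour of a point of [S]. *)
Lemma grid_supported_colours (I : finType) (N : nat) (c : (I -> nat) -> I) :
  exists p : I -> nat, \sum_i p i = N /\ forall i, 0 < p i ->
    exists x : I -> nat, [/\ \sum_i x i = N, c x = i &
      forall j, p j <= x j + #|I| /\ x j <= p j + #|I|].
Proof.
pose V := {x : {ffun I -> 'I_N.+1} | \sum_i x i == N}.
have sumV (x : V) : \sum_i val x i = N by apply/eqP; exact: valP x.
have grid_point (f : I -> nat) : \sum_i f i = N ->
    exists v : V, forall i, val v i = f i :> nat.
  move=> fN; have fle i : f i < N.+1 by rewrite ltnS -fN (bigD1 i)//= leq_addr.
  have P : \sum_i [ffun i => Ordinal (fle i)] i == N.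
    by apply/eqP; rewrite -[RHS]fN; apply: eq_bigr => i _; rewrite ffunE.
  pose x : V := exist (fun x : {ffun I -> 'I_N.+1} => is_true (\sum_i x i == N)) _ P.
  by exists x => i; rewrite /= ffunE.
have [v0 _] : exists v : V, forall i, val v i = (i == c (fun=> 0)) * N :> nat.
  apply: grid_point; rewrite (bigD1 (c (fun=> 0)))//= eqxx mul1n big1 ?addn0//.
  by move=> i /negbTE ->.
have [S [C [[x0 x0S] cC domC]]] :=
  scarf_heights (fun i (x : V) => val x i) (fun x : V => c (fun i => val x i)) v0.
pose m i : nat :=
  if i \in C then nat_of_ord (val [arg min_(x < x0 | x \in S) val x i] i) else 0.
have m_le i (x : V) : x \in S -> m i <= val x i.
  by move=> xS; rewrite /m; case: ifP => // _; case: arg_minnP => // y _; exact.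
have mP i : i \in C -> exists2 x : V, x \in S & val x i = m i :> nat.
  move=> iC; rewrite /m iC; case: arg_minnP => // y yS _; by exists y.
have mN : \sum_i m i <= N.
  by rewrite -(sumV x0); apply: leq_sum => i _; exact: m_le.
have [i0 i0C _] := domC x0.
have sum_bump (f : I -> nat) : \sum_i f i <= N ->
    \sum_i (f i + (i == i0) * (N - \sum_i f i)) = N.
  move=> fN; rewrite big_split/= [X in _ + X](bigD1 i0)//= eqxx mul1n.
  rewrite (_ : \sum_(i | i != i0) _ = 0) ?addn0 ?subnKC//.
  by apply: big1 => i /negbTE ->.
have m_large : N < \sum_i m i + #|I|.
  rewrite ltnNge; apply/negP => small.
  have small' : \sum_i (m i + (i \in C)) <= N.
    apply: leq_trans small; rewrite big_split/= leq_add2l -sum1_card.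
    by apply: leq_sum => i _; exact: leq_b1.
  have [y yE] := grid_point _ (sum_bump _ small').
  have [i iC yi] := domC y; have [x xS xi] := mP i iC.
  by have := yi x xS; rewrite yE xi iC; lia.
exists (fun i => m i + (i == i0) * (N - \sum_i m i)); split; first exact: sum_bump.
move=> i pi.
have iC : i \in C.
  move: pi; have [->//|ii0] := eqVneq i i0.
  by rewrite mul0n addn0 /m; case: ifP.
have [x xS cx] := cC i iC.
exists (fun j => nat_of_ord (val x j)); split=> // j.
have xj : val x j <= m j + (N - \sum_i m i).
  rewrite -[X in X - _](sumV x).
  by apply: (leq_sum_excess (x := fun k => nat_of_ord (val x k))) => k; exact: m_le.
have mj := m_le j x xS; split; last by apply: leq_trans xj _; case: (j == i0); lia.
apply: (@leq_trans (m j + #|I|)); last by rewrite leq_add2r.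
by case: (j == i0); lia.
Qed.

Local Open Scope classical_set_scope.
Local Open Scope ring_scope.

(** * A Hahn-Banach theorem *)

Section inf_bounds.
Variable R : realType.
Implicit Types (E F : set R) (c t : R).

Lemma le_inf_add E F c : E !=set0 -> F !=set0 ->
  (forall e f, E e -> F f -> c <= e + f) -> c <= inf E + inf F.
Proof.
move=> E0 F0 H; rewrite -lerBlDr; apply: lb_le_inf => // e Ee.
rewrite lerBlDr -lerBlDl; apply: lb_le_inf => // f Ff.
by rewrite lerBlDl; exact: H.
Qed.

Lemma le_inf_mul E c t : 0 <= t -> E !=set0 ->
  (forall e, E e -> c <= t * e) -> c <= t * inf E.
Proof.
rewrite le_eqVlt => /orP[/eqP <- [e Ee] H|t0 E0 H].
  by have := H e Ee; rewrite !mul0r.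
rewrite mulrC -ler_pdivrMr//; apply: lb_le_inf => // e Ee.
by rewrite ler_pdivrMr// mulrC; exact: H.
Qed.

End inf_bounds.

Section mazur_orlicz.
Variables (R : realType) (V : lmodType R).
Implicit Types (p q : V -> R) (S : set V) (x y z : V).

Definition sublinear p :=
  (forall x y, p (x + y) <= p x + p y) /\
  (forall t x, 0 <= t -> p (t *: x) <= t * p x).

Lemma sublinear0 p : sublinear p -> p 0 = 0.
Proof.
move=> [pD pZ]; apply/eqP; rewrite eq_le; apply/andP; split.
  by have := pZ 0 0 (lexx _); rewrite scale0r mul0r.
by have := pD 0 0; rewrite addr0 -lerBlDl subrr.
Qed.

Lemma sublinearZ p t x : sublinear p -> 0 <= t -> p (t *: x) = t * p x.
Proof.
move=> sp; rewrite le_eqVlt => /orP[/eqP <-|t0].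
  by rewrite scale0r mul0r sublinear0.
apply/eqP; rewrite eq_le; apply/andP; split; first by apply: sp.2; exact: ltW.
rewrite -ler_pdivlMl//.
have := sp.2 t^-1 (t *: x); rewrite scalerA mulVf ?gt_eqF// scale1r.
by apply; rewrite invr_ge0 ltW.
Qed.

Lemma sublinear_lower p x y : sublinear p -> - p (- x) <= p (x + y) - p y.
Proof.
move=> [pD _]; have := pD (x + y) (- x).
by rewrite addrC addKr; lra.
Qed.

Definition convex_comb_closed S := forall x y (t : R),
  S x -> S y -> 0 <= t -> t <= 1 -> S (t *: x + (1 - t) *: y).

(** The functional [q z = inf (p (z + t *: s) - t * m)], over [t >= 0] and [s] in
[S], is the largest sublinear one below [p] with [q (- s) <= - m] on [S]. *)
Lemma sublinear_push p S (m : R) : sublinear p -> S !=set0 ->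
  convex_comb_closed S -> (forall s, S s -> m <= p s) ->
  exists q, [/\ sublinear q, (forall z, q z <= p z) &
    forall s z, S s -> q z <= p (z + s) - m].
Proof.
move=> sp [s0 Ss0] cS mS; have [pD pZ] := sp.
pose E z := [set p (z + u.1 *: u.2) - u.1 * m | u in [set u : R * V | 0 <= u.1 /\ S u.2]].
have E0 z : E z !=set0.
  by exists (p (z + 0 *: s0) - 0 * m); exists (0, s0).
have Elb z : has_lbound (E z).
  exists (- p (- z)) => _ [[t s] /= [t0 Ss] <-].
  have := sublinear_lower z (t *: s) sp; rewrite sublinearZ//.
  have : t * m <= t * p s by rewrite ler_wpM2l// mS.
  by lra.
have qle z t s : 0 <= t -> S s -> inf (E z) <= p (z + t *: s) - t * m.
  by move=> t0 Ss; apply: ge_inf => //; exists (t, s).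
exists (fun z => inf (E z)); split.
- split=> [x y|t x t0].
    apply: le_inf_add => // _ _ [[t s] /= [t0 Ss] <-] [[t' s'] /= [t'0 Ss'] <-].
    have [tt0|tt0] := eqVneq (t + t') 0.
      have -> : t = 0 by lra.
      have -> : t' = 0 by lra.
      have := qle (x + y) 0 s0 (lexx _) Ss0; have := pD x y.
      by rewrite !scale0r !addr0 !mul0r; lra.
    have tt_gt0 : 0 < t + t' by rewrite lt_neqAle eq_sym tt0 addr_ge0.
    pose s'' := (t / (t + t')) *: s + (1 - t / (t + t')) *: s'.
    have Ss'' : S s''.
      apply: cS => //; first by rewrite divr_ge0// ltW.
      by rewrite ler_pdivrMr// mul1r lerDl.
    have E'' : (t + t') *: s'' = t *: s + t' *: s'.
      rewrite scalerDr !scalerA; congr (_ *: _ + _ *: _); by field.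
    have := qle (x + y) (t + t') s'' (ltW tt_gt0) Ss''; rewrite E''.
    have := pD (x + t *: s) (y + t' *: s').
    by rewrite addrACA; lra.
  apply: le_inf_mul => // _ [[u s] /= [u0 Ss] <-].
  have := qle (t *: x) (t * u) s (mulr_ge0 t0 u0) Ss.
  by rewrite -scalerA -scalerDr sublinearZ//; lra.
- by move=> z; have := qle z 0 s0 (lexx _) Ss0; rewrite scale0r addr0 mul0r subr0.
- by move=> s z Ss; have := qle z 1 s ler01 Ss; rewrite scale1r mul1r.
Qed.

(** Zorn's lemma: the pointwise infimum of a chain of sublinear functionals below
[p] is again sublinear, and finite since [- p (- z)] bounds it from below. *)
Lemma minimal_sublinear p : sublinear p ->
  exists q, [/\ sublinear q, (forall z, q z <= p z) &
    forall q', sublinear q' -> (forall z, q' z <= q z) -> q' = q].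
Proof.
move=> sp.
pose P q := sublinear q /\ forall z, q z <= p z.
pose T := {q : V -> R | P q}.
pose r (a b : T) := `[< forall z, sval b z <= sval a z >].
have [| | | |[q [sq qp]] qmin] := @Zorn T r.
- by move=> a; apply/asboolP.
- move=> a b c /asboolP ab /asboolP bc; apply/asboolP => z.
  exact: le_trans (bc z) (ab z).
- move=> [a Ha] [b Hb] /asboolP/= ab /asboolP/= ba.
  by apply: eq_exist => /=; apply/funext => z; apply/eqP; rewrite eq_le ab ba.
- move=> A totA; have [[a0 Aa0]|A0] := pselect (A !=set0); last first.
    exists (exist P p (conj sp (fun z => lexx (p z)))) => a Aa.
    by exfalso; apply: A0; exists a.
  pose E z := [set sval a z | a in A].
  have E0 z : E z !=set0 by exists (sval a0 z); exists a0.
  have Elb z : has_lbound (E z).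
    exists (- p (- z)) => _ [[a [sa ap]] /= Aa <-].
    have := sublinear_lower z 0 sa; rewrite sublinear0// addr0 subr0.
    by have := ap (- z); lra.
  have Ele z a : A a -> inf (E z) <= sval a z.
    by move=> Aa; apply: ge_inf => //; exists a.
  have sE : sublinear (fun z => inf (E z)).
    split=> [x y|t x t0].
      apply: le_inf_add => // _ _ [a Aa <-] [b Ab <-].
      have [/asboolP ab|/asboolP ba] := totA _ _ Aa Ab.
        apply: le_trans (Ele _ _ Ab) (le_trans ((svalP b).1.1 x y) _).
        by rewrite lerD2r.
      apply: le_trans (Ele _ _ Aa) (le_trans ((svalP a).1.1 x y) _).
      by rewrite lerD2l.
    apply: le_inf_mul => // _ [a Aa <-].
    exact: le_trans (Ele _ _ Aa) ((svalP a).1.2 _ _ t0).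
  have Ep z : inf (E z) <= p z.
    exact: le_trans (Ele _ _ Aa0) ((svalP a0).2 z).
  exists (exist P _ (conj sE Ep)) => a Aa; apply/asboolP => z /=.
  exact: Ele.
- exists q; split=> // q' sq' q'q.
  have q'p z : q' z <= p z := le_trans (q'q z) (qp z).
  have := qmin (exist P q' (conj sq' q'p)) => /(_ _)/(congr1 sval)/=; apply.
  by apply/asboolP.
Qed.

(** A minimal sublinear functional is linear, since pushing it down along a single
point [x] by [sublinear_push] cannot change it, which forces
[f z + f x <= f (z + x)]. *)
Theorem mazur_orlicz p S (m : R) : sublinear p -> S !=set0 ->
  convex_comb_closed S -> (forall s, S s -> m <= p s) ->
  exists f : V -> R, [/\ linear (f : V -> R^o), forall z, f z <= p z &
    forall s, S s -> m <= f s].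
Proof.
move=> sp S0 cS mS.
have [q [sq qp qS]] := sublinear_push sp S0 cS mS.
have [f [sf fq fmin]] := minimal_sublinear sq.
have fD x z : f (z + x) = f z + f x.
  apply/eqP; rewrite eq_le sf.1/=.
  have [] := @sublinear_push f [set x] (f x) sf.
  - by exists x.
  - by move=> _ _ t -> -> _ _; rewrite /= -scalerDl addrC subrK scale1r.
  - by move=> _ ->.
  move=> f' [sf' f'f /(_ x z erefl)]; rewrite (fmin _ sf' f'f); lra.
have fN x : f (- x) = - f x.
  by have := fD x (- x); rewrite addNr sublinear0//; lra.
have fZ t x : f (t *: x) = t * f x.
  have [t0|/ltW t0] := leP 0 t; first exact: sublinearZ.
  rewrite -[t]opprK scaleNr fN mulNr; congr (- _).
  by rewrite sublinearZ// oppr_ge0.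
exists f; split=> [t x y|z|s Ss].
- by rewrite fD fZ.
- exact: le_trans (fq z) (qp z).
- have := qS s (- s) Ss; rewrite addNr sublinear0//.
  by have := fq (- s); rewrite fN; lra.
Qed.

End mazur_orlicz.

(** * Compact operators on reflexive spaces *)

Section weak_limits.
Variable R : realType.
Implicit Types X Y : normedModType R.

Lemma nonexpansive_continuous X Y (f : X -> Y) :
  (forall x y, `|f x - f y| <= `|x - y|) -> continuous f.
Proof.
move=> fle x; apply/cvgrPdist_lt => e e0; near=> z.
apply: le_lt_trans (fle _ _) _; near: z; exact: cvgr_dist_lt.
Unshelve. all: by end_near. Qed.

(** [mazur_orlicz] for the norm and the translate [K - x], on which the norm is
bounded below by the distance of [x] to [K]. *)
Lemma separate_point X (K : set X) x : closed K -> convex_comb_closed K ->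
  K !=set0 -> ~ K x ->
  exists f d, [/\ @dual R X f, 0 < d & forall k, K k -> f x + d <= f k].
Proof.
move=> clK cK [k0 Kk0] nKx.
have : nbhs x (~` K) by apply: open_nbhs_nbhs; split => //; exact: closed_openC.
move=> /nbhs_normP[d /= d0 dK].
have [] := @mazur_orlicz R X (fun z => `|z|) [set k - x | k in K] d.
- by split=> [y z|t z t0]; [exact: ler_normD|rewrite normrZ ger0_norm].
- by exists (k0 - x); exists k0.
- move=> _ _ t [k Kk <-] [l Kl <-] t0 t1.
  exists (t *: k + (1 - t) *: l); first exact: cK.
  rewrite !scalerBr addrACA -opprD -scalerDl; congr (_ - _).
  by rewrite addrCA subrr addr0 scale1r.
- move=> _ [k Kk <-]; rewrite leNgt; apply/negP => kx.
  by apply: (dK k) => //=; rewrite distrC.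
move=> f [lf fle fK]; pose F : {linear X -> R^o} := HB.pack f (GRing.isLinear.Build _ _ _ _ _ lf).
have fabs z : `|f z| <= `|z|.
  rewrite ler_norml fle andbT lerNl -(raddfN F) /=.
  by rewrite -[leRHS]normrN; exact: fle.
exists f, d; split=> //; last first.
  move=> k Kk; rewrite addrC -lerBrDr -(raddfB F) /=; apply: fK; by exists k.
split=> //; apply: nonexpansive_continuous => y z.
by rewrite -(raddfB F); exact: fabs.
Qed.

Lemma dual_has_ubound X (f : X -> R^o) : dual f ->
  has_ubound [set `|f x| | x in [set x : X | `|x| <= 1]].
Proof.
move=> [lf cf]; pose F : {linear X -> R^o} := HB.pack f (GRing.isLinear.Build _ _ _ _ _ lf).
have /linear_boundedP : bounded_near F (nbhs 0) by apply/linear_bounded_continuous.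
move=> /pinfty_ex_gt0[M M0 fM].
exists M => _ [z /= z1 <-]; apply: le_trans (fM z) _.
by rewrite ler_piMr// ltW.
Qed.

Lemma dual_norm_ge0 X (f : X -> R^o) : dual f -> 0 <= dual_norm f.
Proof.
move=> df; apply: le_trans (normr_ge0 (f 0)) _.
by apply: (ub_le_sup (dual_has_ubound df)); exists 0; rewrite //= normr0.
Qed.

Lemma dual_norm_bound X (f : X -> R^o) x : dual f -> `|f x| <= dual_norm f * `|x|.
Proof.
move=> df; have [lf _] := df.
pose F : {linear X -> R^o} := HB.pack f (GRing.isLinear.Build _ _ _ _ _ lf).
have f0 : f 0 = 0 := raddf0 F.
have fZ a z : f (a *: z) = a * f z := linearZ_LR F a z.
have [->|x0] := eqVneq x 0; first by rewrite f0 !normr0 mulr0.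
have nx : 0 < `|x| by rewrite normr_gt0.
rewrite -ler_pdivrMr//; apply: (ub_le_sup (dual_has_ubound df)).
exists (`|x|^-1 *: x); first by rewrite /= normrZ normfV normr_id mulVf ?gt_eqF.
by rewrite fZ normrM normfV normr_id mulrC.
Qed.

(** An ultrafilter that clusters at a point converges to it. *)
Lemma ultra_compact_cvg T (V : topologicalType) (F : set_system T) (f : T -> V)
    (C : set V) :
  UltraFilter F -> compact C -> F (f @^-1` C) -> exists2 l, C l & f @ F --> l.
Proof.
move=> UF cC FC; have [l [Cl clF]] := cC (f @ F) _ FC.
exists l => // B Bl; have [//|nB] := in_ultra_setVsetC (f @^-1` B) UF.
by have [y []] := clF (~` B) B nB Bl.
Qed.

Lemma weak_limit_mem X (F : set_system X) (K : set X) x : ProperFilter F ->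
  (forall f, dual f -> f @ F --> (f x : R^o)) ->
  closed K -> convex_comb_closed K -> F K -> K x.
Proof.
move=> PF Fx clK cK FK; apply: contrapT => nKx.
have [f [d [df d0 fK]]] := separate_point clK cK (filter_ex FK) nKx.
have /cvgrPdist_lt/(_ d d0) Fd := Fx f df.
have [k [Kk /=]] := filter_ex (filterI FK Fd).
by rewrite distrC => /ltr_normlW; have := fK k Kk; lra.
Qed.

(** Banach-Alaoglu through ultrafilters: the limits of [f] along [F] form a
bounded functional on the dual, which reflexivity represents by a point. *)
Lemma reflexive_weak_cluster X (F : set_system X) (M : R) : reflexive_space X ->
  UltraFilter F -> F [set x | `|x| <= M] ->
  exists x, forall f, dual f -> f @ F --> (f x : R^o).
Proof.
move=> refX UF FM.
have fM f : dual f -> F [set x | `|f x| <= dual_norm f * M].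
  move=> df; apply: filterS FM => x /= xM.
  by apply: le_trans (dual_norm_bound x df) _; rewrite ler_wpM2l// dual_norm_ge0.
have fcvg f : dual f -> cvg (f @ F).
  move=> df; pose B := `[- (dual_norm f * M), dual_norm f * M]%classic.
  have [||l _ fl] := @ultra_compact_cvg _ R^o F f B UF.
  - exact: segment_compact.
  - by apply: filterS (fM f df) => x /=; rewrite /B /= in_itv/= -ler_norml.
  - by apply/cvg_ex; exists l.
have [] := refX (fun f => lim (f @ F)).
  split=> [a f g df dg|].
    apply/cvg_lim => //; apply: cvgD; [apply: cvgZr|]; exact: fcvg.
  exists M => f df; rewrite mulrC.
  exact: cvgr_to_le (cvg_norm (fcvg f df)) (fM f df).
move=> x Hx; exists x => f df; rewrite -Hx//; exact: fcvg.
Qed.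

Lemma compact_operator_continuous X Y (T : {linear X -> Y}) :
  compact_operator T -> continuous T.
Proof.
move=> cT; apply: bounded_linear_continuous.
have : bounded_set [set x : X | `|x| <= 1].
  by exists 1; split=> // M M1 x /= x1; apply: le_trans x1 (ltW M1).
move=> /cT; rewrite precompactE => /compact_bounded[M [Mr HM]].
exists M; split=> // N MN.
apply/nbhs_norm0P; exists 1 => //= x /= /ltW x1.
by apply: HM => //; apply: subset_closure; exists x.
Qed.

(** An ultrafilter on the image converges to some [y] by compactness of [T].
Lifted to [K], it has a weak limit [x].  That [x] lies in [K] and that [T x]
is [y] have the same reason: a weak limit stays in every closed convex set of
the ultrafilter, here in [K] and in the preimages of the balls around [y]. *)
Lemma compact_operator_image X Y (T : {linear X -> Y}) (K : set X) :
  reflexive_space X -> compact_operator T -> bounded_set K -> closed K ->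
  convex_comb_closed K -> compact (T @` K).
Proof.
move=> refX cT bK clK cK; have Tc := compact_operator_continuous cT.
rewrite compact_ultra => G UG GK.
have : compact (closure (T @` K)) by rewrite -precompactE; exact: cT.
rewrite compact_ultra => /(_ G UG); case.
  by apply: filterS GK; exact: subset_closure.
move=> y [_ /= Gy].
pose F0 := filter_from G (fun A => K `&` T @^-1` A).
have PF0 : ProperFilter F0.
  apply: filter_from_proper; first apply: filter_from_filter.
  - by exists setT; exact: filterT.
  - move=> A B GA GB; exists (A `&` B); first exact: filterI.
    by move=> x [Kx [Ax Bx]].
  - by move=> A GA; have [z [Az [x Kx Txz]]] := filter_ex (filterI GA GK); exists x; split=> //=; rewrite Txz.
have [F [UF F0F]] := ultraFilterLemma PF0.
have FK : F K by apply: F0F; exists setT; [exact: filterT|move=> x []].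
have [M [Mr HM]] := bK.
have [x Fx] : exists x, forall f, dual f -> f @ F --> (f x : R^o).
  apply: (@reflexive_weak_cluster _ F (M + 1)) => //.
  by apply: filterS FK => x Kx /=; apply: HM => //; rewrite ltrDl.
exists y; split=> //; exists x; first exact: weak_limit_mem FK.
apply/eqP; rewrite -subr_eq0 -normr_le0; apply/ler_addgt0Pl => e e0; rewrite addr0.
apply: (@weak_limit_mem X F [set x | `|T x - y| <= e]) => //.
- apply: (@closed_comp _ _ (fun x => `|T x - y|) [set r | r <= e]).
    by move=> z _; apply: cvg_norm; apply: cvgB; [exact: Tc|exact: cvg_cst].
  exact: closed_le.
- move=> u v t /= ue ve t0 t1.
  have -> : T (t *: u + (1 - t) *: v) - y = t *: (T u - y) + (1 - t) *: (T v - y).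
    rewrite linearD !linearZ !scalerBr addrACA -opprD -scalerDl; congr (_ - _).
    by rewrite addrCA subrr addr0 scale1r.
  apply: le_trans (ler_normD _ _) _; rewrite !normrZ !ger0_norm ?subr_ge0//.
  have : t * `|T u - y| <= t * e by rewrite ler_wpM2l.
  have : (1 - t) * `|T v - y| <= (1 - t) * e by rewrite ler_wpM2l// subr_ge0.
  by lra.
- apply: F0F; exists [set z | `|z - y| <= e]; last by move=> z [].
  by apply: Gy; apply/nbhs_normP; exists e => //= z /ltW; rewrite /= distrC.
Qed.

End weak_limits.

Lemma compact_banach_prod (R : realType) (I : finType)
    (Y : I -> completeNormedModType R) (C : forall i, set (Y i)) :
  (forall i, compact (C i)) ->
  compact [set y : banach_prod Y | forall i, C i (y i)].
Proof.
move=> cC; rewrite compact_ultra => F UF FC.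
have Fi i : exists l, C i l /\ (fun y : banach_prod Y => y i) @ F --> l.
  have [|l Cl Fl] := @ultra_compact_cvg _ _ F
    (fun y : banach_prod Y => y i) (C i) UF (cC i).
    by apply: filterS FC => y; exact.
  by exists l.
pose l : banach_prod Y := fun i => projT1 (cid (Fi i)).
have lP i : C i (l i) /\ (fun y : banach_prod Y => y i) @ F --> l i.
  exact: projT2 (cid (Fi i)).
exists l; split=> [i|]; first exact: (lP i).1.
apply/cvgrPdist_le => e e0.
have : \forall y \near F, forall i, `|l i - y i| <= e.
  by apply: filter_forall => i; move/cvgrPdist_le: (lP i).2; exact.
by apply: filterS => y ly; apply/banach_prod_norm_le => //; exact: ltW.
Qed.

Lemma proj_banach_continuous (R : realType) (I : finType)
    (Y : I -> completeNormedModType R) i :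
  continuous (fun y : banach_prod Y => y i).
Proof.
apply: nonexpansive_continuous => y z.
exact: (banach_prod_norm_le (y - z) (normr_ge0 _)).1.
Qed.

(** * Upper bounds for difference quotients *)

Section upper_slopes.
Variables (R : realType) (Z : normedModType R).
Implicit Types (j : Z -> R) (y h v : Z) (c t : R).

(** A form of [clarke j y h <= c] without extended reals: it is stable under sums
and positive multiples of [h], and under moving [y] at the price of a small
increase of [c]. *)
Definition slope_le j y h c :=
  \forall p \near filter_prod (nbhs y) (0^'+),
    (j (p.1 + p.2 *: h) - j p.1) / p.2 <= c.

Lemma clarke_lt j y h c : (clarke j y h < c%:E)%E ->
  exists2 c', c' < c & slope_le j y h c'.
Proof.
rewrite /clarke limf_esupE => /ereal_inf_lt[_ [P FP <-] supP].
have [c' c'c Pc'] : exists2 c', c' < c &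
    (ereal_sup [set ((j (p.1 + p.2 *: h) - j p.1) / p.2)%:E | p in P] <= c'%:E)%E.
  case: (ereal_sup _) supP => [s| |]//.
    by rewrite lte_fin => sc; exists s.
  by exists (c - 1); rewrite ?leNye//; lra.
exists c' => //; apply: filterS FP => p Pp; rewrite -lee_fin.
by apply: le_trans Pc'; apply: ereal_sup_ubound; exists p.
Qed.

(** A one-sided derivative only sees the base point [w = y] in the upper limit. *)
Lemma directional_lt_clarke j y h c (l : \bar R) : (clarke j y h < c%:E)%E ->
  ((j (y + t *: h) - j y) / t)%:E @[t --> 0^'+] --> l -> (l < c%:E)%E.
Proof.
move=> /clarke_lt[c' c'c [[P Q] [/= Py Q0] PQ]] jl.
apply: (@le_lt_trans _ _ c'%:E); last by rewrite lte_fin.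
apply: cvge_to_le jl _; apply: filterS Q0 => t Qt; rewrite lee_fin.
apply: (PQ (y, t)); split=> //=; exact: nbhs_singleton.
Qed.

Lemma cvg_shift y h :
  p.1 + p.2 *: h @[p --> filter_prod (nbhs y) (0^'+)] --> y.
Proof.
rewrite -[X in _ --> X]addr0 -[X in _ --> _ + X](scale0r h); apply: cvgD.
  exact: cvg_fst.
apply: cvgZr_tmp; apply: cvg_trans (@cvg_snd _ _ _ _ _) _.
exact: cvg_within.
Qed.

(** The step along [h1 + h2] from [w] is split at [w + t *: h1], which also tends
to [y]. *)
Lemma slope_leD j y h1 h2 c1 c2 : slope_le j y h1 c1 -> slope_le j y h2 c2 ->
  slope_le j y (h1 + h2) (c1 + c2).
Proof.
move=> H1 H2.
have shift : (p.1 + p.2 *: h1, p.2) @[p --> filter_prod (nbhs y) (0^'+)] -->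
    filter_prod (nbhs y) (0^'+).
  exact: (@cvg_pair _ _ _ _ (nbhs y) (0^'+) _ _ _ _ _ (@cvg_shift y h1) cvg_snd).
have H2' : \forall p \near filter_prod (nbhs y) (0^'+),
  (j (p.1 + p.2 *: h1 + p.2 *: h2) - j (p.1 + p.2 *: h1)) / p.2 <= c2.
  exact: shift H2.
apply: filterS2 H1 H2' => p q1 q2; rewrite scalerDr addrA.
have -> : j (p.1 + p.2 *: h1 + p.2 *: h2) - j p.1 =
    (j (p.1 + p.2 *: h1) - j p.1) +
    (j (p.1 + p.2 *: h1 + p.2 *: h2) - j (p.1 + p.2 *: h1)) by ring.
by rewrite mulrDl lerD.
Qed.

Lemma slope_leZ j y h c t : 0 < t -> slope_le j y h c -> slope_le j y (t *: h) (t * c).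
Proof.
move=> t0 H.
have dilate : (t * u) @[u --> 0^'+] --> 0^'+.
  move=> P P0; have t_cvg : (t * u) @[u --> (0 : R)] --> (0 : R).
    by rewrite -[X in _ --> X](mulr0 t); apply: cvgMl_tmp; exact: cvg_id.
  suff : \forall u \near (0 : R), 0 < u -> P (t * u) by [].
  have near_tu : \forall u \near (0 : R), 0 < t * u -> P (t * u) by exact: t_cvg P0.
  apply: filterS near_tu => u Pu u0; apply: Pu.
  by rewrite mulr_gt0.
have scale : (p.1, t * p.2) @[p --> filter_prod (nbhs y) (0^'+)] -->
    filter_prod (nbhs y) (0^'+).
  exact: (@cvg_pair _ _ _ _ (nbhs y) (0^'+) _ _ _ _ _ cvg_fst (cvg_comp _ _ cvg_snd dilate)).
have H' : \forall p \near filter_prod (nbhs y) (0^'+),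
  (j (p.1 + (t * p.2) *: h) - j p.1) / (t * p.2) <= c by exact: scale H.
apply: filterS H' => p q; rewrite scalerA [p.2 * t]mulrC.
have -> : (j (p.1 + (t * p.2) *: h) - j p.1) / p.2 =
    t * ((j (p.1 + (t * p.2) *: h) - j p.1) / (t * p.2)).
  by rewrite invfM mulrCA mulVKf ?gt_eqF.
by rewrite ler_pM2l.
Qed.

Lemma slope_le0 j y c : slope_le j y 0 c -> 0 <= c.
Proof. by move=> /filter_ex[p /=]; rewrite scaler0 addr0 subrr mul0r. Qed.

Lemma slope_le_sum (I : finType) j y (h : I -> Z) (c t : I -> R) :
  (forall i, 0 <= t i) -> (forall i, 0 < t i -> slope_le j y (h i) (c i)) ->
  slope_le j y (\sum_i t i *: h i) (\sum_i t i * c i).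
Proof.
move=> t0 H; elim/big_rec2 : _ => [|i c' h' _ Hi].
  by apply: nearW => p; rewrite scaler0 addr0 subrr mul0r.
have := t0 i; rewrite le_eqVlt => /orP[/eqP <-|ti].
  by rewrite scale0r mul0r !add0r.
by apply: slope_leD => //; apply: slope_leZ => //; exact: H.
Qed.

Lemma near_filter_prod (P : Z * R -> Prop) y :
  (\forall p \near filter_prod (nbhs y) (0^'+), P p) ->
  \forall y' \near y, \forall p \near filter_prod (nbhs y') (0^'+), P p.
Proof.
move=> [[A B] [/= Ay B0] AB]; apply: filterS (nbhs_interior Ay) => y' Ay'.
by exists (A, B).
Qed.

(** Joint upper semicontinuity of the Clarke derivative in the base point and the
direction: changing the direction by [y - y'] changes the quotients by at most
the Lipschitz constant times its norm. *)
Lemma slope_le_near j y v c e : locally_lipschitz j -> 0 < e ->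
  slope_le j y (v - y) c -> \forall y' \near y, slope_le j y' (v - y') (c + e).
Proof.
move=> jL e0 H; have [U Uy jU] := jL y.
have /pinfty_ex_gt0[L L0 jUL] := jU.
have Hn := near_filter_prod H.
have Un := near_filter_prod (@cvg_shift y (v - y) _ Uy).
have [d /= d0 dU] : exists2 d, 0 < d & forall z, `|y - z| < d -> U z.
  by have /nbhs_normP[d d0 dU] := Uy; exists d => // z; exact: dU.
have d20 : 0 < d / 2 by rewrite divr_gt0.
have M0 : 0 < `|v - y| + 1 by rewrite ltr_wpDl.
have near_y (r : R) : 0 < r -> \forall y' \near y, `|y - y'| < r.
  by move=> r0; apply/nbhs_normP; exists r.
(* These bounds keep p.1 + p.2 *: (v - y') in the ball of radius d, on which j
   is Lipschitz, as soon as y' is at distance at most 1 from y. *)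
have Vn : \forall y' \near y, \forall p \near filter_prod (nbhs y') (0^'+),
    `|y - p.1| < d / 2 /\ 0 < p.2 /\ p.2 < Num.min 1 (d / 2 / (`|v - y| + 1)).
  apply: near_filter_prod; exists ([set z | `|y - z| < d / 2],
    [set t | 0 < t /\ t < Num.min 1 (d / 2 / (`|v - y| + 1))]) => /=.
    split; first by exact: near_y.
    apply: filterI; first exact: nbhs_right_gt.
    by apply: nbhs_right_lt; rewrite lt_min ltr01 divr_gt0.
  by move=> p /= [].
near=> y'.
have Un' : \forall p \near filter_prod (nbhs y') (0^'+), U (p.1 + p.2 *: (v - y)).
  by near: y'.
have Hn' : \forall p \near filter_prod (nbhs y') (0^'+),
    (j (p.1 + p.2 *: (v - y)) - j p.1) / p.2 <= c by near: y'.
have Vn' : \forall p \near filter_prod (nbhs y') (0^'+),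
    `|y - p.1| < d / 2 /\ 0 < p.2 /\ p.2 < Num.min 1 (d / 2 / (`|v - y| + 1)) by near: y'.
have y'1 : `|y - y'| < 1 by near: y'; exact: near_y.
have y'e : `|y - y'| < e / L by near: y'; apply: near_y; rewrite divr_gt0.
apply: filterS3 Un' Hn' Vn' => p Up Hp [p1 [p20 ]].
rewrite lt_min => /andP[p21 p2d].
have Up' : U (p.1 + p.2 *: (v - y')).
  apply: dU; rewrite opprD addrA; apply: le_lt_trans (ler_normB _ _) _.
  rewrite normrZ (gtr0_norm p20); have : p.2 * `|v - y'| < d / 2; last by lra.
  apply: (@le_lt_trans _ _ (p.2 * (`|v - y| + 1))); last by rewrite -ltr_pdivlMr.
  rewrite ler_pM2l// (_ : v - y' = (v - y) + (y - y')); last by rewrite addrA subrK.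
  by apply: le_trans (ler_normD _ _) _; rewrite lerD2l ltW.
have Lip : `|j (p.1 + p.2 *: (v - y')) - j (p.1 + p.2 *: (v - y))| <=
    L * (p.2 * `|y - y'|).
  have E : p.1 + p.2 *: (v - y') - (p.1 + p.2 *: (v - y)) = p.2 *: (y - y').
    rewrite opprD addrACA subrr add0r -scalerBr; congr (_ *: _).
    by rewrite opprB addrC addrA subrK.
  have := jUL (p.1 + p.2 *: (v - y'), p.1 + p.2 *: (v - y)) (conj Up' Up) => /=.
  by rewrite E normrZ (gtr0_norm p20).
rewrite ler_pdivrMr//; move: Hp; rewrite ler_pdivrMr// => Hp.
have : L * (p.2 * `|y - y'|) <= e * p.2.
  by rewrite mulrCA mulrC ler_pM2r// mulrC -ler_pdivlMr// ltW.
by have := ler_norm (j (p.1 + p.2 *: (v - y')) - j (p.1 + p.2 *: (v - y))); lra.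
Unshelve. all: by end_near. Qed.

End upper_slopes.

(** * Open covers of compact convex sets *)

Section supported_covers.
Variables (R : realType) (Z : normedModType R).

Lemma convex_comb_sum (C : set Z) (I : finType) (v : I -> Z) (t : I -> R) :
  convex_comb_closed C -> (forall i, C (v i)) -> (forall i, 0 <= t i) ->
  \sum_i t i = 1 -> C (\sum_i t i *: v i).
Proof.
move=> cC Cv t0 t1.
have key (r : seq I) : 0 < \sum_(i <- r) t i ->
    C ((\sum_(i <- r) t i)^-1 *: \sum_(i <- r) t i *: v i).
  elim: r => [|i r IH]; first by rewrite big_nil ltxx.
  rewrite !big_cons => s0.
  have r0 : 0 <= \sum_(j <- r) t j by apply: sumr_ge0.
  move: r0; rewrite le_eqVlt => /orP[/eqP r0|r0].
    have -> : \sum_(j <- r) t j *: v j = 0.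
      rewrite big_seq big1// => j jr; have /eqP := esym r0.
      rewrite psumr_eq0// => /allP/(_ j jr)/eqP ->.
      by rewrite scale0r.
    by move: s0; rewrite -r0 !addr0 => s0; rewrite scalerA mulVf ?gt_eqF// scale1r.
  set s := \sum_(j <- r) t j in s0 r0 IH *.
  have a0 : 0 <= t i / (t i + s) by rewrite divr_ge0// ltW.
  have a1 : t i / (t i + s) <= 1 by rewrite ler_pdivrMr// mul1r lerDl ltW.
  have := cC (v i) (s^-1 *: \sum_(j <- r) t j *: v j) (t i / (t i + s)) (Cv i) (IH r0) a0 a1.
  rewrite scalerDr !scalerA [_^-1 * t i]mulrC.
  have -> // : (1 - t i / (t i + s)) * s^-1 = (t i + s)^-1.
  have : t i + s != 0 by rewrite gt_eqF.
  have : s != 0 by rewrite gt_eqF.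
  by move=> ? ?; field; apply/andP.
have := key (index_enum I); rewrite t1 invr1 scale1r; apply; exact: ltr01.
Qed.

Lemma compact_lebesgue_number (C : set Z) (I : finType) (U : I -> set Z) :
  compact C -> (forall i, open (U i)) -> (forall y, C y -> exists i, U i y) ->
  exists2 d : R, 0 < d & forall y, C y -> exists i, forall z, `|y - z| < d -> U i z.
Proof.
move=> /compact_near_coveringP cC oU CU.
have near_d : \forall d \near (0 : R)^'+, C `<=`
    (fun y => exists i, forall z, `|y - z| < d -> U i z).
  apply: cC => y Cy; have [i Uiy] := CU y Cy.
  have /nbhs_normP[e /= e0 eU] : nbhs y (U i) by apply: open_nbhs_nbhs; split.
  exists ([set y' | `|y - y'| < e / 2], [set d | d < e / 2]) => /=.
    split; first by apply/nbhs_normP; exists (e / 2) => //=; rewrite divr_gt0.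
    by apply: nbhs_right_lt; rewrite divr_gt0.
  move=> [y' d] /= [yy' de]; exists i => z y'z; apply: eU => /=.
  rewrite (_ : y - z = (y - y') + (y' - z)); last by rewrite addrA subrK.
  apply: le_lt_trans (ler_normD _ _) _; lra.
have [d [d0 dC]] := filter_ex (filterI (nbhs_right_gt (0 : R)) near_d).
by exists d.
Qed.

(** Finitely many [U v] suffice; index the vertices of a simplex by these [v] and
map it to [C] by convex combinations.  Colour a grid point [x] by some [v] such
that [U v] contains the ball of radius [d] around the image of [x].  The point
[p] of [grid_supported_colours] is so close to points of each colour in its
support that its image lies in the corresponding [U v]. *)
Theorem open_cover_supported (C : set Z) (U : Z -> set Z) :
  compact C -> C !=set0 -> convex_comb_closed C ->
  (forall v, C v -> open (U v)) -> (forall y, C y -> exists2 v, C v & U v y) ->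
  exists (I : finType) (v : I -> Z) (t : I -> R),
    [/\ forall i, C (v i), forall i, 0 <= t i, \sum_i t i = 1 &
      forall i, 0 < t i -> U (v i) (\sum_j t j *: v j)].
Proof.
move=> cC [y0 Cy0] convC oU CU.
have := cC; rewrite {1}compact_cover => /(_ Z C U oU) [|D DC CD].
  by move=> y /CU[v Cv Uv]; exists v.
have CD' (i : D) : C (val i) by apply: set_mem; exact: DC (valP i).
have [|y Cy|d d0 dU] := @compact_lebesgue_number C D (fun i => U (val i)) cC.
- by move=> i; apply: oU.
- by have [v /= vD Uv] := CD y Cy; exists [` vD]%fset.
have [i1 _] := dU y0 Cy0.
have /choice[L LP] : forall y, exists i : D, C y -> forall z, `|y - z| < d -> U (val i) z.
  move=> y; have [/dU[i iU]|nC] := pselect (C y); first by exists i.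
  by exists i1.
pose M := \sum_(i : D) `|val i|.
have M0 : 0 <= M by apply: sumr_ge0.
(* Grid points at coordinatewise distance #|D| have images at distance at most
   #|D| / N * M. *)
have [N [N0 NM]] : exists N : nat, 0 < N%:R :> R /\ #|{: D}|%:R / N%:R * M < d.
  pose a : R := d^-1 * (#|{: D}|%:R * M); exists (Num.bound a).+1; rewrite ltr0Sn; split=> //.
  rewrite mulrAC ltr_pdivrMr ?ltr0Sn// -ltr_pdivrMl//.
  apply: (@lt_trans _ _ (Num.bound a)%:R); last by rewrite ltr_nat.
  by rewrite archi_boundP// !mulr_ge0// invr_ge0 ltW.
pose pt (x : D -> nat) : Z := \sum_i (x i)%:R / N%:R *: val i.
have pt_sum (x : D -> nat) : (\sum_i x i)%N = N -> \sum_i (x i)%:R / N%:R = 1 :> R.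
  by move=> xN; rewrite -mulr_suml -natr_sum xN mulfV ?gt_eqF.
have ptC (x : D -> nat) : (\sum_i x i)%N = N -> C (pt x).
  by move=> xN; apply: convex_comb_sum => //; exact: pt_sum.
have [p [pN pP]] := @grid_supported_colours D N (fun x => L (pt x)).
exists D, (fun i => val i), (fun i => (p i)%:R / N%:R); split=> //.
  exact: pt_sum.
move=> i; rewrite pmulr_lgt0 ?invr_gt0// ltr0n => /pP[x [xN <- xp]].
apply: LP; first exact: ptC.
apply: le_lt_trans NM; rewrite /pt -sumrB /M mulr_sumr.
apply: le_trans (ler_norm_sum _ _ _) _; apply: ler_sum => j _.
rewrite -scalerBl normrZ ler_wpM2r// -mulrBl normrM normfV (gtr0_norm N0).
rewrite ler_pM2r ?invr_gt0// ler_norml.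
have [] := xp j; rewrite -!(ler_nat R) !natrD; lra.
Qed.

End supported_covers.

(** * Existence of a point without descent *)

Lemma convex_set_comb (R : realType) (X : normedModType R) (K : set X) :
  convex_set K -> convex_comb_closed K.
Proof.
move=> cK x y t Kx Ky t0 t1.
exact: set_mem (cK x y (Itv01 t0 t1) (mem_set Kx) (mem_set Ky)).
Qed.

Lemma slice_shift (R : realType) (I : finType) (Y : I -> completeNormedModType R)
    (f : banach_prod Y -> R) (y h : banach_prod Y) i (t : R) :
  (forall k, k != i -> h k = 0) ->
  slice f y i (y i + t *: h i) = f (y + t *: h).
Proof.
move=> h0; rewrite /slice; congr f; apply: functional_extensionality_dep => k.
have [->|ki] := eqVneq k i; first by rewrite dfwithin.
rewrite dfwithout 1?eq_sym//.
have -> : (y + t *: h) k = y k + t *: h k by [].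
by rewrite h0// scaler0 addr0.
Qed.

Lemma slice_id (R : realType) (I : finType) (Y : I -> completeNormedModType R)
    (f : banach_prod Y -> R) (y : banach_prod Y) i :
  slice f y i (y i) = f y.
Proof.
rewrite /slice; congr f; apply: functional_extensionality_dep => k.
have [->|ki] := eqVneq k i; first by rewrite dfwithin.
by rewrite dfwithout 1?eq_sym.
Qed.

(** Along the [i]th axis, [J] and its slice have the same one-sided difference
quotients at [y]; regularity makes [clarke J y h] their limit. *)
Lemma regular_clarke_lt_partial (R : realType) (I : finType)
    (Y : I -> completeNormedModType R) (J : banach_prod Y -> R)
    (y h : banach_prod Y) i (c : R) :
  regular J -> (forall k, k != i -> h k = 0) ->
  (partial_clarke J i y (h i) < c%:E)%E -> (clarke J y h < c%:E)%E.
Proof.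
move=> J_reg h0 /directional_lt_clarke; apply.
suff -> : (fun t => ((slice J y i (y i + t *: h i) - slice J y i (y i)) / t)%:E) =
    (fun t => ((J (y + t *: h) - J y) / t)%:E) by exact: J_reg.
by apply/funext => t; rewrite slice_shift// slice_id.
Qed.

Lemma continuous_comp_sub (R : realType) (T : topologicalType) (V : normedModType R)
    (g : T -> V) (f : T * V -> R) (a : V) :
  continuous g -> continuous f -> continuous (fun y => f (y, a - g y)).
Proof.
move=> g_cont f_cont y.
apply: (@continuous_comp _ _ _ (fun y => (y, a - g y)) f); last exact: f_cont.
apply: cvg_pair; first exact: cvg_id.
by apply: cvgB; [exact: cvg_cst|exact: g_cont].
Qed.

Section inequality.
Variables (R : realType) (I : finType) (Y : I -> completeNormedModType R).
Variables (A : I -> banach_prod Y -> R) (J : banach_prod Y -> R).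
Hypothesis dA_cont : forall i,
  continuous (fun p : banach_prod Y * Y i => partial_diff (A i) i p.1 p.2).
Hypothesis J_lip : locally_lipschitz J.
Local Notation Z := (banach_prod Y).
Implicit Types (y h v : Z).

Definition total_diff y h : R := \sum_i partial_diff (A i) i y (h i).

(** The existence of [c] expresses [total_diff y (v - y) + J°(y; v - y) < 0]. *)
Definition descent v : set Z := [set y | exists2 c,
  slope_le J y (v - y) c & total_diff y (v - y) + c < 0].

Lemma total_diff_sum (D : finType) y (h : D -> Z) (t : D -> R) :
  total_diff y (\sum_j t j *: h j) = \sum_j t j * total_diff y (h j).
Proof.
have proj (i : I) : (\sum_j t j *: h j) i = \sum_j t j *: h j i.
  by elim/big_rec2 : _ => // j a b _ <-.
rewrite /total_diff; under [RHS]eq_bigr do rewrite mulr_sumr.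
rewrite exchange_big; apply: eq_bigr => i _.
rewrite proj /partial_diff linear_sum; apply: eq_bigr => j _.
by rewrite linearZ.
Qed.

Lemma open_descent v : open (descent v).
Proof.
rewrite openE => y [c Hc tc]; rewrite /interior.
have cont : continuous (fun y => total_diff y (v - y)).
  apply: continuous_big => [|i _]; first exact: add_continuous.
  exact: continuous_comp_sub (@proj_banach_continuous _ _ Y i) (@dA_cont i).
(* One third of the slack is spent on each of the two summands. *)
pose e := - (total_diff y (v - y) + c) / 3.
have e0 : 0 < e by rewrite /e; lra.
have near_slope := slope_le_near J_lip e0 Hc.
have /cvgrPdist_lt/(_ e e0) near_diff := cont y.
apply: filterS2 near_slope near_diff => y' Hy' dy'.
exists (c + e) => //.
have := ler_norm (total_diff y' (v - y') - total_diff y (v - y)).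
by rewrite distrC; move: dy'; rewrite /e; lra.
Qed.

(** Otherwise [open_cover_supported] applies to the sets [descent v].  At the point
[p] that it gives, the weighted sum of the directions [v j - p] is zero, so the
differentials cancel and the weighted sum of the bounds [c j] bounds the
quotients along the direction 0, which vanish. *)
Theorem no_descent (C : set Z) : compact C -> C !=set0 -> convex_comb_closed C ->
  exists2 y, C y & forall v, C v -> ~ descent v y.
Proof.
move=> cC C0 convC; apply: contrapT => no_y.
have [|D [v [t [Cv t0 t1 tD]]]] := open_cover_supported cC C0 convC
  (fun v _ => open_descent (v := v)).
  move=> y Cy; apply: contrapT => no_v; apply: no_y.
  by exists y => // v Cv vy; apply: no_v; exists v.
set p := \sum_j t j *: v j in tD.
have /choice[c cP] : forall j, exists c, 0 < t j ->
    slope_le J p (v j - p) c /\ total_diff p (v j - p) + c < 0.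
  move=> j; have [/tD[c Hc tc]|tj] := ltP 0 (t j); first by exists c.
  by exists 0.
have sum0 : \sum_j t j *: (v j - p) = 0.
  by under eq_bigr do rewrite scalerBr; rewrite sumrB -scaler_suml t1 scale1r subrr.
have c_ge0 : 0 <= \sum_j t j * c j.
  apply: (@slope_le0 _ _ J p); rewrite -sum0; apply: slope_le_sum => // j tj.
  by have [] := cP j tj.
have total0 : \sum_j t j * total_diff p (v j - p) = 0.
  rewrite -total_diff_sum sum0 /total_diff big1// => i _.
  by rewrite /partial_diff linear0.
have : 0 <= \sum_j (t j * total_diff p (v j - p) + t j * c j).
  by rewrite big_split/= total0 add0r.
rewrite leNgt => /negP; apply.
have [j tj] : exists j, 0 < t j.
  apply: contrapT => tn; have /eqP := t1; rewrite big1 ?[0 == 1]eq_sym ?oner_eq0//.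
  by move=> j _; apply/eqP; rewrite eq_le t0 andbT leNgt; apply/negP => tj; apply: tn; exists j.
have neg k : 0 < t k -> t k * total_diff p (v k - p) + t k * c k < 0.
  by move=> tk; rewrite -mulrDr pmulr_rlt0//; have [] := cP k tk.
rewrite (bigD1 j)//= -[ltRHS]addr0 ltr_leD ?neg//.
apply: sumr_le0 => k _; have := t0 k; rewrite le_eqVlt => /orP[/eqP <-|/neg/ltW//].
by rewrite !mul0r addr0.
Qed.

End inequality.

Theorem corollary4p1 (R : realType) (n : nat)
  (X Y : 'I_n -> completeNormedModType R)
  (T : forall i, {linear X i -> Y i})
  (K : forall i, set (X i))
  (A : 'I_n -> banach_prod Y -> R)
  (J : banach_prod Y -> R)
  (X_reflexive : forall i, reflexive_space (X i))
  (T_compact : forall i, compact_operator (T i))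
  (K_nonempty : forall i, K i !=set0)
  (K_bounded : forall i, bounded_set (K i))
  (K_closed : forall i, closed (K i))
  (K_convex : forall i, convex_set (K i))
  (A_continuous : forall i, continuous (A i))
  (A_lipschitz : forall i y, locally_lipschitz (slice (A i) y i))
  (A_differentiable : forall i (y : banach_prod Y),
    differentiable (slice (A i) y i) (y i))
  (dA_continuous : forall i,
    continuous (fun p : banach_prod Y * Y i => partial_diff (A i) i p.1 p.2))
  (J_lipschitz : locally_lipschitz J)
  (J_regular : regular J) :
  exists2 u0 : forall i, X i, (forall i, K i (u0 i)) &
    forall u : forall i, X i, (forall i, K i (u i)) ->
    forall i, (0 <= (partial_diff (A i) i (fun k => T k (u0 k))
                       (T i (u i) - T i (u0 i))%R)%:E
                  + partial_clarke J i (fun k => T k (u0 k))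
                       (T i (u i) - T i (u0 i))%R)%E.
Proof.
pose C : set (banach_prod Y) := [set y | forall i, (T i @` K i) (y i)].
have cC : compact C.
  apply: (@compact_banach_prod R _ Y (fun i => T i @` K i)) => i.
  exact: (compact_operator_image (@X_reflexive i) (@T_compact i) (@K_bounded i)
    (@K_closed i) (convex_set_comb (@K_convex i))).
have C0 : C !=set0.
  exists (fun i => T i (projT1 (cid (K_nonempty i)))) => i.
  by exists (projT1 (cid (K_nonempty i))) => //; exact: projT2 (cid _).
have convC : convex_comb_closed C.
  move=> x y t Cx Cy t0 t1 i; have [a Ka ax] := Cx i; have [b Kb bx] := Cy i.
  exists (t *: a + (1 - t) *: b); first exact: (convex_set_comb (@K_convex i)).
  have -> : (t *: x + (1 - t) *: y) i = t *: x i + (1 - t) *: y i by [].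
  by rewrite linearD !linearZ ax bx.
have [y Cy ny] := no_descent dA_continuous J_lipschitz cC C0 convC.
pose u0 i := s2val (cid2 (Cy i)).
have Ku0 i : K i (u0 i) := s2valP (cid2 (Cy i)).
have Tu0 i : T i (u0 i) = y i := s2valP' (cid2 (Cy i)).
exists u0 => // u Ku i.
have -> : (fun k => T k (u0 k)) = y :> banach_prod Y.
  by apply: functional_extensionality_dep.
rewrite leNgt; apply/negP => neg.
pose v : banach_prod Y := dfwith y i (T i (u i)).
have vi : v i = T i (u i) by rewrite /v dfwithin.
have h0 k : k != i -> (v - y) k = 0.
  move=> ki; have -> : (v - y) k = v k - y k by [].
  by rewrite /v dfwithout 1?eq_sym// subrr.
have hi : (v - y) i = T i (u i) - T i (u0 i) by rewrite Tu0 -vi.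
have Cv : C v.
  by move=> k; rewrite /v; case: dfwithP => [|j _]; [exists (u i)|exact: Cy].
have total : total_diff A y (v - y) = partial_diff (A i) i y ((v - y) i).
  rewrite /total_diff (bigD1 i)//= big1 ?addr0// => k ki.
  by rewrite h0// /partial_diff linear0.
apply: (ny v Cv); rewrite -hi in neg.
have partial_lt : (partial_clarke J i y ((v - y)%R i) <
    (- partial_diff (A i) i y ((v - y) i))%R%:E)%E.
  case: (partial_clarke _ _ _ _) neg => [r| |]; rewrite ?addey ?ltNyr//.
  by rewrite -EFinD !lte_fin; lra.
have [c c_lt Hc] := clarke_lt (regular_clarke_lt_partial J_regular h0 partial_lt).
by exists c; rewrite // total; lra.
Qed.
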